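(* Let $l \geq 1$ be an integer and $N = 2^{l+1}-1$. Let ${\rm MTD}_{l,2} \subset \Delta_N$ be the binary mixture transition distribution model and $\overline{{\rm MTD}}_{l,2} \subset \mathbb{P}^N$ its Zariski closure (both defined in the context). Then: (1) The variety $\overline{{\rm MTD}}_{l,2}$ is a linear subspace of dimension $l+1$ in the projective space $\mathbb{P}^N$. (2) The intersection $\overline{{\rm MTD}}_{l,2} \cap \Delta_N$ of this variety with the probability simplex $\Delta_N$ is a regular cross-polytope of dimension $l+1$. (3) The model ${\rm MTD}_{l,2}$ is the union of two $(l+1)$-dimensional simplices, each spanned by (i.e. the convex hull of) vertices of the cross-polytope $\overline{{\rm MTD}}_{l,2} \cap \Delta_N$, and these two simplices meet along a common edge.
   Context: Fix positive integers $l$ and $m$ (here $m=2$), set $N = m^{l+1}-1$ and $[m]=\{1,\ldots,m\}$. Write $\Delta_k$ for the standard $k$-dimensional probability simplex in $\mathbb{R}^{k+1}$. The simplex $\Delta_N$ has coordinates $p_{i_0 i_1 \cdots i_l}$ indexed by sequences $i_0 i_1\cdots i_l \in [m]^{l+1}$; the same $p_{i_0\cdots i_l}$ serve as homogeneous coordinates on the complex projective space $\mathbb{P}^N$, and $\Delta_N$ is regarded as a subset of $\mathbb{P}^N$ via these coordinates. The model ${\rm MTD}_{l,m}$ is the image of the map $\phi_{l,m} : (\Delta_{m-1})^m \times \Delta_{l-1} \to \Delta_N$ whose input is an $m\times m$ transition matrix $(q_{ij})$ (non-negative entries, each row summing to $1$) together with a probability distribution $\lambda=(\lambda_1,\ldots,\lambda_l)$,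 and which is given by $$ p_{i_0 i_1 \cdots i_{l-1} i_l} = \frac{1}{m^l} \sum_{j=1}^{l} \lambda_j\, q_{i_{j-1},\, i_l}. $$ $\overline{{\rm MTD}}_{l,m}$ denotes the Zariski closure of ${\rm MTD}_{l,m}$ in $\mathbb{P}^N$. A regular cross-polytope of dimension $d$ is a polytope similar (in the Euclidean sense) to the convex hull of the signed unit vectors $\pm e_1,\ldots,\pm e_d$ in $\mathbb{R}^d$. *)

(* Defs.v *)
(* The complex numbers are [R[i]], for an arbitrary [R : realType]. *)
From HB Require Import structures.
From mathcomp Require Import all_boot all_order all_algebra.
From mathcomp Require Import classical_sets reals convex.
From mathcomp Require Import complex.
From mathcomp Require Import mpoly.

Set Implicit Arguments.
Unset Strict Implicit.
Unset Printing Implicit Defensive.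

Import Order.TTheory GRing.Theory Num.Theory.
Local Open Scope classical_set_scope.
Local Open Scope ring_scope.

Section Projective.
Variables (F : fieldType) (n : nat).

(* The points of P(F^n), which has dimension n - 1, are the lines of F^n. *)
Definition proj_space := {L : {vspace 'rV[F]_n} | \dim L == 1%N}.

(* Since the line is one-dimensional, this forces v != 0. *)
Definition homog_coords (x : proj_space) (v : 'rV[F]_n) : Prop :=
  val x = <[v]>%VS.

Definition vanishes_at (f : {mpoly F[n]}) (x : proj_space) : Prop :=
  forall v, homog_coords x v -> f.@[fun k => v ord0 k] = 0.

Definition zariski_closed (Z : set proj_space) : Prop :=
  exists2 I : set {mpoly F[n]},
    (forall f, I f -> exists d, f \is d.-homog) &
    Z = [set x | forall f, I f -> vanishes_at f x].

Definition zariski_closure (S : set proj_space) : set proj_space :=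
  smallest zariski_closed S.

Definition linear_subspace (d : nat) (Z : set proj_space) : Prop :=
  exists2 W : {vspace 'rV[F]_n}, \dim W = d.+1 &
    Z = [set x : proj_space | (val x <= W)%VS].

End Projective.

Section Polytopes.
Variable R : realType.

Definition hull n (A : set 'rV[R]_n) : set 'rV[R]_n :=
  smallest (@convex_set R 'rV[R]_n) A.

Definition dot n (x y : 'rV[R]_n) : R := \sum_k x ord0 k * y ord0 k.

(* The library norm on row vectors is the sup norm, hence this definition. *)
Definition edist n (x y : 'rV[R]_n) : R := Num.sqrt (dot (x - y) (x - y)).

Definition similarity a b (f : 'rV[R]_a -> 'rV[R]_b) : Prop :=
  exists2 r : R, 0 < r & forall x y, edist (f x) (f y) = r * edist x y.

Definition std_cross_polytope d : set 'rV[R]_d :=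
  hull (range (fun i : 'I_d => delta_mx ord0 i)
        `|` range (fun i : 'I_d => - delta_mx ord0 i)).

Arguments std_cross_polytope d : clear implicits.

Definition regular_cross_polytope d n (K : set 'rV[R]_n) : Prop :=
  exists2 f : 'rV[R]_d -> 'rV[R]_n, similarity f &
    K = f @` std_cross_polytope d.

(* A face is cut out by a linear inequality [dot c x <= b] valid on K. *)
Definition face n (K F : set 'rV[R]_n) : Prop :=
  exists c : 'rV[R]_n, exists2 b : R,
    (forall x, K x -> dot c x <= b) & F = [set x | K x /\ dot c x = b].

Definition vertex n (K : set 'rV[R]_n) (v : 'rV[R]_n) : Prop :=
  face K [set v].

Definition edge n (K E : set 'rV[R]_n) : Prop :=
  face K E /\ exists v w, v <> w /\ E = hull [set v; w].

Definition affinely_independent n d (v : 'I_d -> 'rV[R]_n) : Prop :=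
  forall c : 'I_d -> R,
    \sum_i c i = 0 -> \sum_i c i *: v i = 0 -> forall i, c i = 0.

(* The standard simplex of dimension n - 1 in R^n. *)
Definition prob_simplex n : set 'rV[R]_n :=
  [set p | (forall k, 0 <= p ord0 k) /\ \sum_k p ord0 k = 1].

(* Subsets of R^n and of P(C^n) are compared through real homogeneous
   coordinates: [to_proj A] is the image of A in P(C^n), and [real_points Z]
   consists of the real vectors that represent a point of Z. *)
Definition to_proj n (A : set 'rV[R]_n) : set (proj_space R[i] n) :=
  [set x | exists2 p, A p & homog_coords x (map_mx (real_complex R) p)].

Definition real_points n (Z : set (proj_space R[i] n)) : set 'rV[R]_n :=
  [set p | exists2 x, Z x & homog_coords x (map_mx (real_complex R) p)].

End Polytopes.

Arguments prob_simplex R n : clear implicits.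
Arguments std_cross_polytope R d : clear implicits.

(* The coordinate p_w, for a sequence w = i_0 ... i_l of states, has index
   [enum_rank w]. *)
Definition num_words l m : nat := #|{: l.+1.-tuple 'I_m}|.

Lemma num_wordsE l m : (0 < m)%N -> num_words l m = (m ^ l.+1 - 1).+1.
Proof.
by move=> m0; rewrite /num_words card_tuple card_ord subn1 prednK // expn_gt0 m0.
Qed.

Section Model.
Variables (R : realType) (l m : nat).

(* The states 1, ..., m are numbered from 0, and so is the index of lambda:
   its entry j is the weight of the state i_j. *)
Definition mtd_map (q : 'M[R]_m) (lambda : 'rV[R]_l) : 'rV[R]_(num_words l m) :=
  \row_k let w : l.+1.-tuple 'I_m := enum_val k in
    (m ^ l)%:R^-1 *
    \sum_(j < l) lambda ord0 j * q (tnth w (widen_ord (leqnSn l) j))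
                                   (tnth w ord_max).

Definition transition_matrix (q : 'M[R]_m) : Prop :=
  forall i, prob_simplex R m (row i q).

Definition MTD : set 'rV[R]_(num_words l m) :=
  [set p | exists q lambda,
     [/\ transition_matrix q, prob_simplex R l lambda & p = mtd_map q lambda]].

Definition MTD_closure : set (proj_space R[i] (num_words l m)) :=
  zariski_closure (to_proj MTD).

End Model.

Arguments MTD R l m : clear implicits.
Arguments MTD_closure R l m : clear implicits.

(* Main.v *)
(* Put s(0) = 1, s(1) = -1, and let chi_j(w) = s(w_j) s(w_l) for j < l and
   chi_l(w) = s(w_l).  In the parameters x_j = (q_00 - q_10) lambda_j for j < l
   and x_l = q_00 + q_10 - 1, the model reads
     p_w = 2^-(l+1) (1 + sum_j x_j chi_j(w)).
   The functions 1, chi_0, ..., chi_l are orthogonal of norm 2^((l+1)/2), so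
   x |-> p is a similarity.  As (chi_0(w), ..., chi_l(w)) runs over all sign
   vectors, p >= 0 means |x_0| + ... + |x_l| <= 1: the affine span of the model
   cuts the simplex in a cross-polytope.  The model itself is the part where
   x_0, ..., x_(l-1) all have the same weak sign.  Each of the two signs gives a
   simplex on l+2 vertices, and a polynomial vanishing on the cone over one of
   them vanishes on its complex linear span. *)
Require Import Defs.
From HB Require Import structures.
From mathcomp Require Import all_boot all_order all_algebra.
From mathcomp Require Import classical_sets reals convex.
From mathcomp Require Import complex.
From mathcomp Require Import mpoly.
From mathcomp Require Import boolp interval_inference.
From mathcomp Require Import ring lra.

Set Implicit Arguments.
Unset Strict Implicit.
Unset Printing Implicit Defensive.

Import Order.TTheory GRing.Theory Num.Theory.
Local Open Scope classical_set_scope.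
Local Open Scope ring_scope.

(** * Zariski closure of a cone *)

Lemma poly_natS_roots_eq0 (F : numDomainType) (p : {poly F}) :
  (forall n : nat, p.[n.+1%:R] = 0) -> p = 0.
Proof.
move=> p0; apply/eqP; apply: contraT => pn0.
pose rs : seq F := [seq i.+1%:R | i <- iota 0 (size p)].
have: (size rs < size p)%N.
  apply: (max_poly_roots pn0).
    by apply/allP => x /mapP[i _ ->]; apply/eqP/p0.
  rewrite map_inj_uniq ?iota_uniq// => i j /eqP.
  by rewrite eqr_nat => /eqP[].
by rewrite size_map size_iota ltnn.
Qed.

Lemma meval_line (F : comNzRingType) (n : nat) (f : {mpoly F[n]})
    (u v : 'I_n -> F) :
  exists p : {poly F}, forall t, p.[t] = f.@[fun k => u k + t * v k].
Proof.
exists (\sum_(m <- msupp f) f@_m *: \prod_i ((u i)%:P + v i *: 'X) ^+ m i).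
move=> t; rewrite horner_sum mevalE; apply: eq_bigr => m _.
rewrite hornerZ horner_prod; congr (_ * _); apply: eq_bigr => i _.
by rewrite !hornerE mulrC.
Qed.

(** Vectors of positive integers are Zariski dense in characteristic 0. Such coefficients are also
    real and positive, so the combinations tested stay on the cone over a real simplex. *)
Lemma meval_natS_comb_eq0 (F : numDomainType) (m n : nat) (B : 'M[F]_(m, n))
    (f : {mpoly F[n]}) :
  (forall t : 'I_m -> nat,
    f.@[fun k => ((\row_i (t i).+1%:R) *m B) ord0 k] = 0) ->
  forall c : 'rV[F]_m, f.@[fun k => (c *m B) ord0 k] = 0.
Proof.
move=> f0.
(* Free the coordinates one at a time: a polynomial in one variable with
   infinitely many zeros is zero. *)
have H (k : nat) : (k <= m)%N -> forall c : 'rV[F]_m,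
    (forall i : 'I_m, (k <= i)%N -> exists t : nat, c ord0 i = t.+1%:R) ->
    f.@[fun j => (c *m B) ord0 j] = 0.
  elim: k => [_ c c_nat|k IH km c c_nat].
    have /choice[t ct] := fun i => c_nat i (leq0n _).
    suff -> : c = \row_i (t i).+1%:R by apply: f0.
    by apply/rowP => i; rewrite mxE ct.
  pose k' := Ordinal km.
  pose u : 'rV[F]_m := \row_i (if i == k' then 0 else c ord0 i).
  pose e : 'rV[F]_m := delta_mx ord0 k'.
  have eq_line t : (fun j => ((u + t *: e) *m B) ord0 j) =
      (fun j => (u *m B) ord0 j + t * (e *m B) ord0 j).
    by apply/funext => j; rewrite mulmxDl -scalemxAl [LHS]mxE;
      congr (_ + _); rewrite [LHS]mxE.
  have [p pE] := meval_line f (fun j => (u *m B) ord0 j)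
    (fun j => (e *m B) ord0 j).
  have p0 : p = 0.
    apply: poly_natS_roots_eq0 => t; rewrite pE -eq_line.
    apply: IH => [|i ki]; first exact: ltnW.
    rewrite /u /e !mxE eqxx /=; case: (eqVneq i k') => [_|ik].
      by exists t; rewrite mulr1 add0r.
    rewrite mulr0 addr0; apply: c_nat.
    by rewrite ltn_neqAle ki andbT eq_sym.
  have -> : c = u + c ord0 k' *: e.
    apply/rowP => i; rewrite !mxE eqxx /=; case: eqVneq => [->|_].
      by rewrite mulr1 add0r.
    by rewrite mulr0 addr0.
  by rewrite eq_line -pE p0 horner0.
by move=> c; apply: (H m) => // i; rewrite leqNgt ltn_ord.
Qed.

(** * The projective linear subspace spanned by the rows of a matrix *)

Section RowSpace.
Variables (F : fieldType) (m n : nat) (B : 'M[F]_(m, n)).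

Lemma ex_homog_coords (x : proj_space F n) : exists v, homog_coords x v.
Proof.
case: x => L dL; exists (vpick L); apply/eqP; rewrite eq_sym /=.
by rewrite eqEdim -memvE memv_pick (eqP dL) dim_vline vpick0 -dimv_eq0 (eqP dL).
Qed.

Lemma homog_coords_exists (v : 'rV[F]_n) :
  v != 0 -> exists x : proj_space F n, homog_coords x v.
Proof.
move=> v0.
have dv : \dim <[v]> == 1%N by rewrite dim_vline v0.
by exists (exist _ <[v]>%VS dv).
Qed.

Lemma homog_coordsZ (x : proj_space F n) v (a : F) :
  a != 0 -> homog_coords x v -> homog_coords x (a *: v).
Proof.
rewrite /homog_coords => a0 ->; apply/eqP.
rewrite eqEsubv -!memvE memvZ ?memv_line// andbT.
by rewrite -[X in X \in _](scalerK a0) memvZ ?memv_line.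
Qed.

Definition row_vspace : {vspace 'rV[F]_n} :=
  limg (linfun (mulmxr B : 'rV[F]_m -> 'rV[F]_n)).

Lemma mem_row_vspace (v : 'rV[F]_n) : (v \in row_vspace) = (v <= B)%MS.
Proof.
apply/memv_imgP/submxP => [[c _ ->]|[c ->]]; exists c; rewrite ?memvf//.
  by rewrite lfunE.
by rewrite lfunE.
Qed.

Lemma dim_row_vspace : row_free B -> \dim row_vspace = m.
Proof.
move=> /row_free_inj Binj; rewrite limg_dim_eq ?dimvf /dim /= ?mul1n//.
apply/eqP; rewrite -subv0; apply/subvP => c.
rewrite memv_cap memvf /= memv_ker lfunE /= memv0 => /eqP cB.
by apply/eqP; apply: Binj; rewrite cB mul0mx.
Qed.

Definition row_variety : set (proj_space F n) :=
  [set x | (val x <= row_vspace)%VS].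

Lemma row_varietyE (x : proj_space F n) v :
  homog_coords x v -> row_variety x <-> (v <= B)%MS.
Proof. by rewrite /row_variety /= => ->; rewrite -memvE mem_row_vspace. Qed.

Lemma zariski_closed_row_variety : zariski_closed row_variety.
Proof.
(* The columns of [cokermx B] are linear equations for the row space of [B]. *)
pose f j : {mpoly F[n]} := \sum_k cokermx B k j *: 'X_k.
have fE j (v : 'rV[F]_n) : (f j).@[fun k => v ord0 k] = (v *m cokermx B) ord0 j.
  rewrite /f raddf_sum mxE; apply: eq_bigr => k _.
  by rewrite /= mevalZ mevalXU mulrC.
exists (range f).
  move=> _ [j _ <-]; exists 1%N; apply: rpred_sum => k _.
  by apply: dhomogZ; rewrite dhomogX /= mdeg1.
apply/seteqP; split => [x|x].
  move=> xB _ [j _ <-] v xv; rewrite fE.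
  by move/(row_varietyE xv): xB; rewrite submxE => /eqP ->; rewrite mxE.
move=> xf; have [v xv] := ex_homog_coords x.
apply/(row_varietyE xv); rewrite submxE; apply/eqP/rowP => j.
by rewrite -fE mxE; apply: xf => //; exists j.
Qed.

End RowSpace.

(** A polynomial vanishing on [S] vanishes on all positive integer combinations of the rows, hence
    on the whole row space, so every closed set containing [S] contains the row variety. *)
Lemma zariski_closure_row_variety (F : numFieldType) (m n : nat)
    (B : 'M[F]_(m, n)) (S : set (proj_space F n)) :
  S `<=` row_variety B ->
  (forall t : 'I_m -> nat, exists2 x, S x &
    homog_coords x ((\row_i (t i).+1%:R) *m B)) ->
  zariski_closure S = row_variety B.
Proof.
move=> SB BS; apply/seteqP; split.
  by apply: smallest_sub => //; apply: zariski_closed_row_variety.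
move=> x xB Z [[I _ ->] SZ] f If v xv.
move/(row_varietyE B xv): xB => /submxP[c ->].
apply: meval_natS_comb_eq0 => t; have [y Sy yt] := BS t.
exact: (SZ _ Sy _ If _ yt).
Qed.

(** * Convex hulls of finite families *)

Lemma convex_setP (R : realType) n (A : set 'rV[R]_n) :
  convex_set A <-> forall x y t, 0 <= t <= 1 -> A x -> A y ->
    A (t *: x + (1 - t) *: y).
Proof.
split => [cA x y t /andP[t0 t1] Ax Ay|cA x y t].
  by have := cA x y (Itv01 t0 t1) (mem_set Ax) (mem_set Ay); rewrite inE.
rewrite !inE => Ax Ay; apply: cA => //.
by apply/andP; split.
Qed.

Lemma hull_range (R : realType) n (I : finType) (v : I -> 'rV[R]_n) :
  hull (range v) = [set x | exists c : I -> R,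
    [/\ forall i, 0 <= c i, \sum_i c i = 1 & x = \sum_i c i *: v i]].
Proof.
apply/seteqP; split.
  apply: smallest_sub.
    apply/convex_setP => _ _ t /andP[t0 t1] [c [c0 c1 ->]] [d [d0 d1 ->]].
    exists (fun i => t * c i + (1 - t) * d i); split.
    - by move=> i; rewrite addr_ge0// mulr_ge0// subr_ge0.
    - by rewrite big_split -!mulr_sumr /= c1 d1 !mulr1 addrC subrK.
    - rewrite !scaler_sumr -big_split; apply: eq_bigr => i _ /=.
      by rewrite [RHS]scalerDl -!scalerA.
  move=> _ [i _ <-]; exists (fun j => (j == i)%:R); split.
  - by move=> j; rewrite ler0n.
  - by rewrite (bigD1 i)//= eqxx big1 ?addr0// => j /negPf ->.
  - rewrite (bigD1 i)//= eqxx scale1r big1 ?addr0// => j /negPf ->.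
    by rewrite scale0r.
move=> _ [c [c0 c1 ->]] A [/convex_setP cA vA].
(* The point [y], of weight [t], stands for the part already summed. *)
have key (s : seq I) y t : A y -> 0 <= t -> t + \sum_(i <- s) c i = 1 ->
    A (t *: y + \sum_(i <- s) c i *: v i).
  elim: s y t => [|i s IH] y t Ay t0.
    by rewrite !big_nil !addr0 => ->; rewrite scale1r.
  rewrite !big_cons !addrA => s1; have tc0 := addr_ge0 t0 (c0 i).
  (* If the weights of [y] and [v i] sum to 0, both vanish and no normalization is possible; [y] is
     kept with weight 0. *)
  have [tc|tc] := eqVneq (t + c i) 0.
    have /andP[/eqP tz /eqP cz] : (t == 0) && (c i == 0).
      by rewrite -paddr_eq0// tc.
    move: s1; rewrite tz cz !scale0r !addr0 => s1.
    by have := IH y 0 Ay (lexx _) s1; rewrite scale0r.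
  have -> : t *: y + c i *: v i = (t + c i) *:
      (t / (t + c i) *: y + (1 - t / (t + c i)) *: v i).
    rewrite scalerDr !scalerA mulrBr mulr1 [_ * (t / _)]mulrC divfK//.
    by rewrite addrAC subrr add0r.
  apply: IH => //; apply: cA => //; last by apply: vA; exists i.
  rewrite divr_ge0//= ler_pdivrMr ?mul1r ?lerDl ?c0//.
  by rewrite lt_def tc.
(* The induction starts with weight 0, so any member of the family can serve as [y]; an empty family
   contradicts total weight 1. *)
case: (pickP (@predT I)) => [i0 _|I0].
  have := key (index_enum I) (v i0) 0 _ (lexx _).
  by rewrite scale0r !add0r; apply => //; apply: vA; exists i0.
by move: c1; rewrite big_pred0// => /eqP; rewrite eq_sym oner_eq0.
Qed.

(** * The standard cross-polytope as the unit ball of the l1 norm *)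

Section CrossPolytope.
Variables (R : realType) (d : nat).

Definition l1_ball : set 'rV[R]_d := [set x | \sum_j `|x ord0 j| <= 1].

Lemma std_cross_polytopeE : (0 < d)%N -> std_cross_polytope R d = l1_ball.
Proof.
move=> d0.
pose v (s : 'I_d + 'I_d) : 'rV[R]_d := match s with
  inl i => delta_mx ord0 i | inr i => - delta_mx ord0 i end.
have sum_v (c : 'I_d + 'I_d -> R) j :
    (\sum_s c s *: v s) ord0 j = c (inl j) - c (inr j).
  rewrite summxE big_sumType /= (bigD1 j)//= [X in _ + X](bigD1 j)//=.
  rewrite !mxE !eqxx /= mulr1 mulrN1 !big1 ?addr0// => i /negPf ij;
  by rewrite !mxE eq_sym ij ?oppr0 mulr0.
have -> : std_cross_polytope R d = hull (range v).
  congr hull; apply/seteqP; split => [_ [] [i _ <-]|_ [[i|i] _ <-]].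
  - by exists (inl i).
  - by exists (inr i).
  - by left; exists i.
  - by right; exists i.
rewrite hull_range; apply/seteqP; split.
  move=> _ [c [c0 c1 ->]]; rewrite /l1_ball /= -c1.
  rewrite [leRHS]big_sumType /= -big_split /=.
  apply: ler_sum => j _.
  by rewrite sum_v (le_trans (ler_normB _ _))// !ger0_norm.
move=> x; rewrite /l1_ball /= => x1.
(* The positive and negative parts of [x] have total weight at most 1. The slack is spread evenly
   over the [2 * d] vertices, where opposite vertices cancel. *)
pose e := (1 - \sum_j `|x ord0 j|) / (2 * d%:R).
have e0 : 0 <= e by rewrite divr_ge0 ?subr_ge0// mulr_ge0.
exists (fun s => match s with
  inl i => (`|x ord0 i| + x ord0 i) / 2 + e
| inr i => (`|x ord0 i| - x ord0 i) / 2 + e end); split.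
- move=> [i|i]; rewrite addr_ge0// divr_ge0// ?subr_ge0 ?ler_norm//.
  by rewrite -(opprK (x ord0 i)) subr_ge0 normrN ler_norm.
- rewrite big_sumType /= -big_split /=.
  rewrite (eq_bigr (fun i => `|x ord0 i| + 2 * e)); last by move=> i _; field.
  rewrite big_split /= sumr_const card_ord -[_ *+ d]mulr_natl.
  have -> : d%:R * (2 * e) = 1 - \sum_j `|x ord0 j|.
    by rewrite /e; field; rewrite pnatr_eq0 -lt0n.
  by rewrite addrC subrK.
- by apply/rowP => j; rewrite sum_v; field.
Qed.

End CrossPolytope.
Arguments l1_ball R d : clear implicits.

(** * The orthogonal coordinates of the model *)

Section Characters.
Variables (R : realType) (l : nat).

Definition state_sign (i : 'I_2) : R := (-1) ^+ i.

Lemma state_sign_rev i : state_sign (rev_ord i) = - state_sign i.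
Proof.
by case: i => -[|[|//]] ?; rewrite /state_sign /= ?expr0 ?expr1 ?opprK.
Qed.

Lemma state_sign_sq i : state_sign i * state_sign i = 1.
Proof. by rewrite /state_sign -expr2 sqrr_sign. Qed.

Lemma norm_state_sign i : `|state_sign i| = 1.
Proof. by rewrite /state_sign normr_sign. Qed.

Definition chi (j : 'I_l.+1) (w : l.+1.-tuple 'I_2) : R :=
  state_sign (tnth w ord_max) *
  (if j == ord_max then 1 else state_sign (tnth w j)).

Lemma chi_sq j w : chi j w * chi j w = 1.
Proof.
by rewrite /chi mulrACA state_sign_sq mul1r; case: ifP => _;
  rewrite ?mulr1 ?state_sign_sq.
Qed.

Lemma norm_chi j w : `|chi j w| = 1.
Proof.
by rewrite /chi normrM norm_state_sign mul1r; case: ifP => _;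
  rewrite ?normr1 ?norm_state_sign.
Qed.

Definition flip_state (t : 'I_l.+1) (w : l.+1.-tuple 'I_2) : l.+1.-tuple 'I_2 :=
  [tuple if i == t then rev_ord (tnth w i) else tnth w i | i < l.+1].

Lemma flip_stateK t : involutive (flip_state t).
Proof.
move=> w; apply: eq_from_tnth => i; rewrite !tnth_mktuple.
by case: eqP => // _; rewrite rev_ordK.
Qed.

(** Reindexing by the involution [flip_state t] shows that the sum equals its own opposite. *)
Lemma sum_flip_state (F : l.+1.-tuple 'I_2 -> R) t :
  (forall w, F (flip_state t w) = - F w) -> \sum_w F w = 0.
Proof.
move=> FN; have : \sum_w F w = - \sum_w F w.
  rewrite [LHS](reindex_inj (inv_inj (flip_stateK t))) -sumrN.
  by apply: eq_bigr => w _; rewrite FN.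
lra.
Qed.

Lemma chi_flip j w : chi j (flip_state j w) = - chi j w.
Proof.
rewrite /chi !tnth_mktuple eqxx [ord_max == j]eq_sym.
by case: eqP => _; rewrite state_sign_rev ?mulNr ?mulrN.
Qed.

Lemma chi_flip_neq j t w :
  t != ord_max -> t != j -> chi j (flip_state t w) = chi j w.
Proof.
move=> /negPf tm /negPf tj.
by rewrite /chi !tnth_mktuple ![_ == t]eq_sym tm tj.
Qed.

Lemma sum_chi j : \sum_w chi j w = 0.
Proof. by apply: (@sum_flip_state _ j) => w; rewrite chi_flip. Qed.

Lemma sum_chiM i j : \sum_w chi i w * chi j w = 2 ^+ l.+1 * (i == j)%:R.
Proof.
have [->|ij] := eqVneq i j.
  rewrite (eq_bigr (fun=> 1)) => [|w _]; last by rewrite chi_sq.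
  by rewrite sumr_const card_tuple card_ord mulr1 natrX.
(* The last state enters every [chi], so another one is flipped. As [i] and [j] differ, one of them
   is not [ord_max], and flipping there negates only its own factor. *)
rewrite mulr0; have [im|im] := eqVneq i ord_max.
  apply: (@sum_flip_state _ j) => w.
  by rewrite chi_flip chi_flip_neq ?mulrN// -?im eq_sym.
by apply: (@sum_flip_state _ i) => w; rewrite chi_flip chi_flip_neq ?mulNr.
Qed.

Definition chi_sum (x : 'rV[R]_l.+1) w : R := \sum_j x ord0 j * chi j w.

Lemma sum_chi_sum x : \sum_w chi_sum x w = 0.
Proof.
rewrite exchange_big big1//= => j _.
by rewrite -mulr_sumr sum_chi mulr0.
Qed.

Lemma sum_chi_sumM x y : \sum_w chi_sum x w * chi_sum y w = 2 ^+ l.+1 * dot x y.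
Proof.
under eq_bigr do rewrite mulr_suml.
rewrite exchange_big /= mulr_sumr; apply: eq_bigr => i _.
under eq_bigr do rewrite mulr_sumr.
rewrite exchange_big /= (bigD1 i)//= [X in _ + X]big1 => [|j ji].
  under eq_bigr do rewrite mulrACA.
  by rewrite -mulr_sumr sum_chiM eqxx mulr1 addr0 mulrC.
under eq_bigr do rewrite mulrACA.
by rewrite -mulr_sumr sum_chiM eq_sym (negPf ji) !mulr0.
Qed.

Lemma norm_chi_sum x w : `|chi_sum x w| <= \sum_j `|x ord0 j|.
Proof.
rewrite (le_trans (ler_norm_sum _ _ _))//.
by apply: ler_sum => j _; rewrite normrM norm_chi mulr1.
Qed.

Lemma chi_sum_min x : exists w, chi_sum x w = - \sum_j `|x ord0 j|.
Proof.
have sgn_min (y : R) : exists i : 'I_2, state_sign i * y = - `|y|.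
  have [y0|y0] := lerP 0 y; [exists ord_max|exists ord0].
    by rewrite ger0_norm// /state_sign expr1 mulN1r.
  by rewrite ltr0_norm// /state_sign expr0 mul1r opprK.
(* The last state is fixed first, by the last coordinate; each other state then corrects the sign of
   its own [chi] independently. *)
have [i0 i0P] := sgn_min (x ord0 ord_max).
have /boolp.choice[s sP] j := sgn_min (state_sign i0 * x ord0 j).
exists [tuple if j == ord_max then i0 else s j | j < l.+1].
rewrite /chi_sum -sumrN; apply: eq_bigr => j _.
rewrite /chi !tnth_mktuple eqxx; case: eqP => [->|_].
  by rewrite mulr1 mulrC.
by rewrite mulrA mulrC [x _ _ * _]mulrC sP normrM norm_state_sign mul1r.
Qed.

Lemma chi_sumD x y w : chi_sum (x + y) w = chi_sum x w + chi_sum y w.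
Proof. by rewrite -big_split; apply: eq_bigr => j _; rewrite mxE mulrDl. Qed.

Lemma chi_sumZ a x w : chi_sum (a *: x) w = a * chi_sum x w.
Proof. by rewrite mulr_sumr; apply: eq_bigr => j _; rewrite mxE mulrA. Qed.

Lemma chi_sumB x y w : chi_sum (x - y) w = chi_sum x w - chi_sum y w.
Proof. by rewrite -scaleN1r chi_sumD chi_sumZ mulN1r. Qed.

Lemma chi_sum_sum (I : finType) (F : I -> 'rV[R]_l.+1) w :
  chi_sum (\sum_i F i) w = \sum_i chi_sum (F i) w.
Proof.
rewrite /chi_sum exchange_big; apply: eq_bigr => j _.
by rewrite summxE mulr_suml.
Qed.

(** * The affine embedding given by the characters *)

Definition chi_row (x : 'rV[R]_l.+1) : 'rV[R]_(num_words l 2) :=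
  \row_k chi_sum x (enum_val k).

Definition chi_point (x : 'rV[R]_l.+1) : 'rV[R]_(num_words l 2) :=
  \row_k ((2 ^+ l.+1)^-1 * (1 + chi_sum x (enum_val k))).

Lemma sum_words (F : l.+1.-tuple 'I_2 -> R) :
  \sum_(k < num_words l 2) F (enum_val k) = \sum_w F w.
Proof. by rewrite -(big_enum_val (A := {: l.+1.-tuple 'I_2})). Qed.

Lemma pow2_neq0 n : 2 ^+ n != 0 :> R.
Proof. by rewrite expf_neq0// pnatr_eq0. Qed.

(** The constant term is orthogonal to every [chi], and the factor of [chi_point] cancels their
    squared norm. Thus [chi_row] carries linear functionals over to the image, which yields
    injectivity and the transport of faces. *)
Lemma dot_chi_point u x : dot (chi_row u) (chi_point x) = dot u x.
Proof.
rewrite /dot; under eq_bigr do rewrite !mxE.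
rewrite (sum_words (fun w => chi_sum u w * (_ * (1 + chi_sum x w)))).
under eq_bigr do rewrite mulrCA mulrDr mulr1.
by rewrite -mulr_sumr big_split /= sum_chi_sum sum_chi_sumM add0r mulKf//.
Qed.

Lemma dot_delta (x : 'rV[R]_l.+1) j : dot (delta_mx ord0 j) x = x ord0 j.
Proof.
rewrite /dot (bigD1 j)//= !mxE !eqxx mul1r big1 ?addr0// => i /negPf ij.
by rewrite !mxE ij mul0r.
Qed.

Lemma chi_point_inj : injective chi_point.
Proof.
move=> x y xy; apply/rowP => j.
by rewrite -!dot_delta -!dot_chi_point xy.
Qed.

Lemma similarity_chi_point : similarity chi_point.
Proof.
(* Squared lengths gain [2 ^+ l.+1] from the norm of the characters and lose its square to the
   factor of [chi_point]. *)
exists (Num.sqrt (2 ^+ l.+1)^-1) => [|x y].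
  by rewrite sqrtr_gt0 invr_gt0 exprn_gt0.
rewrite /edist -sqrtrM ?invr_ge0 ?exprn_ge0//; congr Num.sqrt.
have -> : chi_point x - chi_point y = (2 ^+ l.+1)^-1 *: chi_row (x - y).
  by apply/rowP => k; rewrite !mxE chi_sumB; ring.
rewrite /dot; under eq_bigr do rewrite !mxE.
rewrite (sum_words (fun w => _ * chi_sum _ w * (_ * chi_sum _ w))).
under eq_bigr do rewrite mulrACA.
by rewrite -mulr_sumr sum_chi_sumM -!mulrA mulKf ?pow2_neq0.
Qed.

Lemma sum_chi_point x : \sum_k chi_point x ord0 k = 1.
Proof.
under eq_bigr do rewrite mxE.
rewrite (sum_words (fun w => _ * (1 + chi_sum x w))) -mulr_sumr big_split /=.
by rewrite sum_chi_sum addr0 sumr_const card_tuple card_ord natrX mulVf//.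
Qed.

(** The smallest entry of [chi_point x] is a positive multiple of 1 minus the l1 norm of [x], by
    [chi_sum_min]; the entries always sum to 1. *)
Lemma prob_simplex_chi_point x :
  prob_simplex R (num_words l 2) (chi_point x) <-> l1_ball R l.+1 x.
Proof.
rewrite /prob_simplex /l1_ball /=; split => [[x0 _]|x1].
  have [w wE] := chi_sum_min x; move: (x0 (enum_rank w)).
  by rewrite mxE enum_rankK wE pmulr_rge0 ?invr_gt0 ?exprn_gt0// subr_ge0.
split => [k|]; last exact: sum_chi_point.
rewrite mxE mulr_ge0 ?invr_ge0 ?exprn_ge0//.
have := norm_chi_sum x (enum_val k); rewrite ler_norml; lra.
Qed.

(** The total weight is left arbitrary: weight 1 gives affine combinations, weight 0 serves affine
    independence. *)
Lemma chi_point_comb (I : finType) (c : I -> R) (v : I -> 'rV[R]_l.+1) :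
  \sum_i c i *: chi_point (v i) =
  \row_k ((2 ^+ l.+1)^-1 *
    (\sum_i c i + chi_sum (\sum_i c i *: v i) (enum_val k))).
Proof.
apply/rowP => k; rewrite summxE mxE chi_sum_sum -big_split mulr_sumr /=.
by apply: eq_bigr => i _; rewrite !mxE chi_sumZ; ring.
Qed.

Lemma chi_point_aff_comb (I : finType) (c : I -> R) (v : I -> 'rV[R]_l.+1) :
  \sum_i c i = 1 ->
  \sum_i c i *: chi_point (v i) = chi_point (\sum_i c i *: v i).
Proof. by move=> c1; rewrite chi_point_comb c1. Qed.

Lemma hull_chi_point (I : finType) (v : I -> 'rV[R]_l.+1) :
  hull (range (chi_point \o v)) = chi_point @` hull (range v).
Proof.
rewrite !hull_range; apply/seteqP; split => [_ [c [c0 c1 ->]]|].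
  by rewrite chi_point_aff_comb//; eexists; last reflexivity; exists c.
move=> _ [_ [c [c0 c1 ->]] <-]; exists c; split=> //.
by rewrite chi_point_aff_comb.
Qed.

Lemma face_chi_point (A F : set 'rV[R]_l.+1) :
  face A F -> face (chi_point @` A) (chi_point @` F).
Proof.
move=> [c [b cA ->]]; exists (chi_row c), b.
  by move=> _ [x Ax <-]; rewrite dot_chi_point; exact: cA.
apply/seteqP; split => [_ [x [Ax xb] <-]|_ [[x Ax <-]]].
  by split; [exists x|rewrite dot_chi_point].
by rewrite dot_chi_point => xb; exists x.
Qed.

End Characters.

(** * The two simplices *)

Section CrossPolytopeSimplices.
Variables (R : realType) (l : nat).
Implicit Types (s : bool) (x : 'rV[R]_l.+1) (c : 'I_l.+2 -> R).

Notation widen := (widen_ord (leqnSn _)).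

Lemma sum_abs_recr x : \sum_j `|x ord0 j| =
  \sum_(j < l) `|x ord0 (widen j)| + `|x ord0 ord_max|.
Proof. by rewrite big_ord_recr. Qed.

Lemma widen_neq_max n (j : 'I_n) : widen j != ord_max.
Proof. by rewrite -val_eqE /= neq_ltn ltn_ord. Qed.

Lemma ord_recrP n (j : 'I_n.+1) : j != ord_max -> exists i : 'I_n, j = widen i.
Proof.
move=> jm; have jn : (j < n)%N.
  by rewrite ltn_neqAle -ltnS ltn_ord andbT; move: jm; rewrite -val_eqE.
by exists (Ordinal jn); apply: val_inj.
Qed.

(** The first [l] vertices carry the sign chosen by [s]. The last two, a pair of opposite vertices
    of the cross-polytope, do not depend on [s] and span the common edge. *)
Definition cross_vertex s (i : 'I_l.+2) : 'rV[R]_l.+1 :=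
  if i == ord_max then - delta_mx ord0 ord_max
  else if i == widen ord_max then delta_mx ord0 ord_max
  else (-1) ^+ s *: delta_mx ord0 (inord i).

Lemma cross_vertex_widen s (j : 'I_l) :
  cross_vertex s (widen (widen j)) = (-1) ^+ s *: delta_mx ord0 (widen j).
Proof.
rewrite /cross_vertex (negPf (widen_neq_max _)) -val_eqE /=.
rewrite (ltn_eqF (ltn_ord j)); congr (_ *: delta_mx _ _).
by apply: val_inj; rewrite /= inordK// ltnW// ltnS ltn_ord.
Qed.

Lemma cross_vertex_penult s :
  cross_vertex s (widen ord_max) = delta_mx ord0 ord_max.
Proof. by rewrite /cross_vertex (negPf (widen_neq_max _)) eqxx. Qed.

Lemma cross_vertex_max s : cross_vertex s ord_max = - delta_mx ord0 ord_max.
Proof. by rewrite /cross_vertex eqxx. Qed.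

Lemma cross_vertex_comb_widen s c (j : 'I_l) :
  (\sum_i c i *: cross_vertex s i) ord0 (widen j) =
  (-1) ^+ s * c (widen (widen j)).
Proof.
rewrite summxE !big_ord_recr /= cross_vertex_penult cross_vertex_max.
rewrite !mxE (negPf (widen_neq_max _)) andbF oppr0 !mulr0 !addr0.
rewrite (bigD1 j)//= big1 ?addr0 => [|i /negPf ij];
  rewrite cross_vertex_widen !mxE eqxx -val_eqE/=.
  by rewrite eqxx mulr1 mulrC.
by rewrite val_eqE eq_sym ij !mulr0.
Qed.

Lemma cross_vertex_comb_max s c :
  (\sum_i c i *: cross_vertex s i) ord0 ord_max = c (widen ord_max) - c ord_max.
Proof.
rewrite summxE !big_ord_recr /= cross_vertex_penult cross_vertex_max.
rewrite !mxE !eqxx mulr1 mulrN1 big1 ?add0r// => i _.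
by rewrite cross_vertex_widen !mxE eq_sym
  (negPf (widen_neq_max _)) andbF !mulr0.
Qed.

(** Each of the first [l] coordinates isolates one weight; the last one makes the two remaining
    weights equal, and the zero sum then kills them. *)
Lemma cross_vertex_comb_inj s c :
  \sum_i c i = 0 -> \sum_i c i *: cross_vertex s i = 0 -> forall i, c i = 0.
Proof.
move=> c0 cV0.
have cw (j : 'I_l) : c (widen (widen j)) = 0.
  have := cross_vertex_comb_widen s c j; rewrite cV0 mxE => /esym/eqP.
  by rewrite mulrI_eq0 ?signr_eq0 => [/eqP//|]; apply/lregP; rewrite signr_eq0.
have cm := cross_vertex_comb_max s c; rewrite cV0 mxE in cm.
rewrite !big_ord_recr /= big1 ?add0r in c0; last by move=> j _; apply: cw.
move=> i; have [->|/ord_recrP[j ->]] := eqVneq i ord_max; first by lra.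
by have [->|/ord_recrP[k ->//]] := eqVneq j ord_max; lra.
Qed.

Definition cross_simplex s : set 'rV[R]_l.+1 :=
  [set x | l1_ball R l.+1 x /\
    forall j : 'I_l, 0 <= (-1) ^+ s * x ord0 (widen j)].

(** Barycentric coordinates exist for every [x], which also shows that one simplex spans everything;
    only their sign depends on [cross_simplex]. *)
Lemma cross_vertex_coords s x : exists c,
  [/\ \sum_i c i = 1, x = \sum_i c i *: cross_vertex s i &
      cross_simplex s x -> forall i, 0 <= c i].
Proof.
pose y (j : 'I_l) := (-1) ^+ s * x ord0 (widen j).
(* [t] is the weight left for the last two vertices, and [xm] must be the difference of their
   weights. Both are nonnegative when [xm] is at most [t] in absolute value, which is the l1
   bound. *)
pose t := 1 - \sum_j y j; pose xm := x ord0 ord_max.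
pose c (i : 'I_l.+2) : R := if insub (i : nat) is Some j then y j else
  if i == ord_max then (t - xm) / 2 else (t + xm) / 2.
have cw j : c (widen (widen j)) = y j.
  by rewrite /c /= (valK j).
have cp : c (widen ord_max) = (t + xm) / 2.
  by rewrite /c insubF ?ltnn//= (negPf (widen_neq_max _)).
have cm : c ord_max = (t - xm) / 2 by rewrite /c insubF ?eqxx//= ltnNge leqnSn.
exists c; split.
- rewrite !big_ord_recr /= cp cm; under eq_bigr do rewrite cw.
  by rewrite /t; field.
- apply/rowP => j; have [->|/ord_recrP[i ->]] := eqVneq j ord_max.
    by rewrite cross_vertex_comb_max cp cm /xm; field.
  by rewrite cross_vertex_comb_widen cw /y signrMK.
move=> [x1 y0] i.
have : t = 1 - \sum_(j < l) `|x ord0 (widen j)|.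
  congr (1 - _); apply: eq_bigr => j _.
  by rewrite -[LHS]ger0_norm ?y0// normrM normr_sign mul1r.
move: x1; rewrite /l1_ball /= sum_abs_recr -/xm => x1 tE.
have : `|xm| <= t by lra.
rewrite ler_norml => /andP[xt1 xt2].
have [->|/ord_recrP[j ->]] := eqVneq i ord_max; first by rewrite cm; lra.
have [->|/ord_recrP[k ->]] := eqVneq j ord_max; first by rewrite cp; lra.
by rewrite cw y0.
Qed.

Lemma hull_cross_vertex s : hull (range (cross_vertex s)) = cross_simplex s.
Proof.
rewrite hull_range; apply/seteqP; split => [_ [c [c0 c1 ->]]|x xs]; last first.
  have [c [c1 xE c0]] := cross_vertex_coords s x.
  by exists c; split=> //; exact: c0.
split=> [|j]; last by rewrite cross_vertex_comb_widen signrMK.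
rewrite /l1_ball /= sum_abs_recr cross_vertex_comb_max -c1.
rewrite [leRHS]big_ord_recr [X in _ <= X + _]big_ord_recr /=.
rewrite -addrA lerD//.
  apply: ler_sum => j _.
  by rewrite cross_vertex_comb_widen normrM normr_sign mul1r ger0_norm.
by rewrite (le_trans (ler_normB _ _))// !ger0_norm.
Qed.

(** The signed coordinate [j] is at most 1 on the ball; reaching 1 exhausts the l1 norm and forces
    the other coordinates to be 0. *)
Lemma vertex_l1_ball (s : bool) (j : 'I_l.+1) :
  vertex (l1_ball R l.+1) ((-1) ^+ s *: delta_mx ord0 j).
Proof.
have dotE x : dot ((-1) ^+ s *: delta_mx ord0 j) x = (-1) ^+ s * x ord0 j.
  rewrite -dot_delta /dot mulr_sumr; apply: eq_bigr => i _.
  by rewrite mxE mulrA.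
have sgn_le x : (-1) ^+ s * x ord0 j <= `|x ord0 j|.
  by rewrite (le_trans (ler_norm _))// normrM normr_sign mul1r.
exists ((-1) ^+ s *: delta_mx ord0 j), 1.
  move=> x x1; rewrite dotE (le_trans (sgn_le x))// (le_trans _ x1)//.
  by rewrite (bigD1 j)//= lerDl sumr_ge0.
apply/seteqP; split => [_ ->|x [x1]]; rewrite /= ?dotE.
  split; last by rewrite !mxE !eqxx mulr1 -expr2 sqrr_sign.
  rewrite /l1_ball /= (bigD1 j)//= big1 => [|i /negPf ij].
    by rewrite !mxE !eqxx mulr1 normr_sign addr0.
  by rewrite !mxE ij andbF mulr0 normr0.
move=> xj; apply/rowP => i; rewrite !mxE eqxx /=.
have [->|ij] := eqVneq i j.
  by rewrite mulr1 -(signrMK s (x ord0 j)) xj mulr1.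
rewrite mulr0; apply/eqP; rewrite -normr_le0.
have := sgn_le x; rewrite xj => x1j.
move: x1; rewrite /l1_ball /= (bigD1 j)//= (bigD1 i)//=.
have : 0 <= \sum_(k < l.+1 | (k != j) && (k != i)) `|x ord0 k|.
  by rewrite sumr_ge0.
lra.
Qed.

Lemma vertex_cross_vertex s i : vertex (l1_ball R l.+1) (cross_vertex s i).
Proof.
rewrite /cross_vertex; case: ifP => _; last case: ifP => _.
- by rewrite -scaleN1r -[-1]expr1; apply: (vertex_l1_ball true).
- by rewrite -[delta_mx _ _]scale1r -(expr0 (-1));
    apply: (vertex_l1_ball false).
- exact: vertex_l1_ball.
Qed.

(** This segment joins two opposite vertices: it is an edge of each simplex but, for positive [l],
    not of the cross-polytope. *)
Definition cross_diagonal : set 'rV[R]_l.+1 :=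
  [set x | l1_ball R l.+1 x /\ forall j : 'I_l, x ord0 (widen j) = 0].

Lemma cross_simplexI :
  cross_simplex false `&` cross_simplex true = cross_diagonal.
Proof.
apply/seteqP; split => [x [[x1 x0] [_ x2]]|x [x1 x0]].
  split=> // j; have := x0 j; have := x2 j.
  by rewrite expr0 expr1; lra.
by split; split=> // j; rewrite x0 mulr0.
Qed.

Lemma face_cross_diagonal s : face (cross_simplex s) cross_diagonal.
Proof.
(* The functional is minus the sum of the signed coordinates below [ord_max], all nonnegative on the
   simplex, so it is 0 only where they all vanish. *)
pose u : 'rV[R]_l.+1 := \row_j (if j == ord_max then 0 else - (-1) ^+ s).
have dotE x : dot u x = - \sum_(j < l) (-1) ^+ s * x ord0 (widen j).
  rewrite /dot big_ord_recr /= !mxE eqxx mul0r addr0 -sumrN.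
  by apply: eq_bigr => j _; rewrite mxE (negPf (widen_neq_max _)) mulNr.
exists u, 0 => [x [_ x0]|]; first by rewrite dotE oppr_le0 sumr_ge0.
apply/seteqP; split => [x [x1 x0]|x [[x1 x0]]]; rewrite /= dotE.
  split; first by split=> // j; rewrite x0 mulr0.
  by rewrite big1 ?oppr0// => j _; rewrite x0 mulr0.
move/eqP; rewrite oppr_eq0 psumr_eq0// => /allP xw; split=> // j.
by have := xw j (mem_index_enum _); rewrite mulf_eq0 signr_eq0 => /eqP.
Qed.

Lemma hull_cross_diagonal :
  hull (range (fun s : bool => (-1) ^+ s *: delta_mx ord0 ord_max)) =
  cross_diagonal.
Proof.
rewrite hull_range; apply/seteqP; split => [_ [c [c0 c1 ->]]|x [x1 x0]].
  rewrite !big_bool /= expr0 expr1 in c1 *.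
  have x0 (j : 'I_l) : (c true *: (-1 *: delta_mx ord0 ord_max) +
      c false *: (1 *: delta_mx ord0 ord_max) : 'rV[R]_l.+1) ord0 (widen j) = 0.
    by rewrite !mxE (negPf (widen_neq_max _)) !mulr0 addr0.
  split=> //; rewrite /l1_ball /= sum_abs_recr big1 => [|j _].
    rewrite add0r !mxE !eqxx !mulr1 mulrN1 -[leRHS]c1.
    rewrite (le_trans (ler_normD _ _))//.
    by rewrite normrN !ger0_norm.
  by rewrite x0 normr0.
move: x1; rewrite /l1_ball /= sum_abs_recr big1 ?add0r => [|j _]; last first.
  by rewrite x0 normr0.
rewrite ler_norml => /andP[xm1 xm2].
exists (fun s : bool => (1 + (-1) ^+ s * x ord0 ord_max) / 2); split.
- by case; rewrite ?expr0 ?expr1; lra.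
- by rewrite big_bool /= expr0 expr1; field.
- rewrite big_bool; apply/rowP => j; rewrite !mxE /=.
  have [->|/ord_recrP[i ->]] := eqVneq j ord_max.
    by rewrite expr0 expr1 /=; field.
  by rewrite x0 !mulr0 addr0.
Qed.

Lemma affinely_independent_chi_point s :
  affinely_independent (fun i => chi_point (cross_vertex s i)).
Proof.
move=> c c0; rewrite chi_point_comb c0 => V0.
(* With total weight 0 the constant term disappears, so [V0] says that the combination has zero
   [chi_sum] at every word, hence the same [chi_point] as 0. *)
apply: (cross_vertex_comb_inj (s := s)) => //; apply: chi_point_inj.
apply/rowP => k; move/rowP/(_ k)/eqP: V0; rewrite !mxE add0r mulf_eq0.
rewrite invr_eq0 (negPf (pow2_neq0 _ _)) => /eqP ->.
by rewrite -[X in chi_sum X](scale0r 0) chi_sumZ mul0r.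
Qed.

Lemma edge_chi_point s :
  edge (@chi_point R l @` cross_simplex s) (@chi_point R l @` cross_diagonal).
Proof.
split; first exact/face_chi_point/face_cross_diagonal.
pose e (b : bool) : 'rV[R]_l.+1 := (-1) ^+ b *: delta_mx ord0 ord_max.
exists (chi_point (e false)), (chi_point (e true)); split.
  move/chi_point_inj/rowP/(_ ord_max).
  by rewrite !mxE !eqxx expr0 expr1 /=; lra.
rewrite -hull_cross_diagonal -hull_chi_point; congr hull.
apply/seteqP; split=> [_ [[] _ <-]|_ [->|->]]; [by right|by left| |].
  by exists false.
by exists true.
Qed.

End CrossPolytopeSimplices.

(** * The model and its closure *)

Section BinaryModel.
Variables (R : realType) (l : nat).
Notation widen := (widen_ord (leqnSn _)).

Definition mtd_coords (q : 'M[R]_2) (lambda : 'rV[R]_l) : 'rV[R]_l.+1 :=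
  \row_j if insub (j : nat) is Some i
    then (q ord0 ord0 - q ord_max ord0) * lambda ord0 i
    else q ord0 ord0 + q ord_max ord0 - 1.

Lemma mtd_coords_widen q lambda (i : 'I_l) :
  mtd_coords q lambda ord0 (widen i) =
  (q ord0 ord0 - q ord_max ord0) * lambda ord0 i.
Proof. by rewrite mxE /= (valK i). Qed.

Lemma mtd_coords_max q lambda :
  mtd_coords q lambda ord0 ord_max = q ord0 ord0 + q ord_max ord0 - 1.
Proof. by rewrite mxE insubF //= ltnn. Qed.

Lemma ord2P (i : 'I_2) : i = ord0 \/ i = ord_max.
Proof.
by case: i => -[|[|//]] ?; [left|right]; apply: val_inj.
Qed.

Lemma sum_ord2 (F : 'I_2 -> R) : \sum_i F i = F ord0 + F ord_max.
Proof.
rewrite big_ord_recr big_ord1 /=; congr (F _ + _).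
exact: val_inj.
Qed.

(** Row sums 1 leave only the first column free; writing all four entries by one formula in the
    signs of [i] and [j] makes the characters appear. *)
Lemma transition_matrixE (q : 'M[R]_2) i j : transition_matrix q ->
  q i j = (1 + state_sign R j * (q ord0 ord0 + q ord_max ord0 - 1 +
    (q ord0 ord0 - q ord_max ord0) * state_sign R i)) / 2.
Proof.
move=> tq.
have q1 k : q k ord0 + q k ord_max = 1.
  by have [_] := tq k; rewrite sum_ord2 !mxE.
have q1max := q1 ord_max; have q10 := q1 ord0.
by have [->|->] := ord2P i; have [->|->] := ord2P j;
  rewrite /state_sign !(expr0, expr1); lra.
Qed.

Lemma mtd_map_chi_point (q : 'M[R]_2) (lambda : 'rV[R]_l) :
  transition_matrix q -> prob_simplex R l lambda ->
  mtd_map q lambda = chi_point (mtd_coords q lambda).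
Proof.
move=> tq [_ lambda1]; apply/rowP => k; rewrite !mxE /chi_sum.
set w := enum_val k; rewrite big_ord_recr /= mtd_coords_max.
rewrite /chi eqxx mulr1 natrX exprS invfM -mulrA [RHS]mulrCA; congr (_ * _).
set a := q ord0 ord0; set b := q ord_max ord0.
set e := state_sign R (tnth w ord_max).
(* Each term splits into a part that depends on [j] only through [lambda], summed by [lambda1], and
   a multiple of [chi] at [j]. *)
transitivity (\sum_(j < l) (lambda ord0 j * ((1 + e * (a + b - 1)) / 2) +
    2^-1 * ((a - b) * lambda ord0 j * (e * state_sign R (tnth w (widen j)))))).
  apply: eq_bigr => j _; rewrite (transition_matrixE _ _ tq) -/a -/b -/e.
  by field.
rewrite big_split /= -mulr_suml lambda1 -mulr_sumr mul1r.
rewrite [X in _ = _ * (1 + (X + _))](eq_bigr (fun j => (a - b) *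
    lambda ord0 j * (e * state_sign R (tnth w (widen j))))); last first.
  by move=> j _; rewrite mtd_coords_widen (negPf (widen_neq_max _)).
by field.
Qed.

Lemma cross_simplex_mtd_coords (q : 'M[R]_2) (lambda : 'rV[R]_l) :
  transition_matrix q -> prob_simplex R l lambda ->
  cross_simplex (q ord0 ord0 < q ord_max ord0) (mtd_coords q lambda).
Proof.
move=> tq [lambda0 lambda1].
have q01 k : 0 <= q k ord0 <= 1.
  have [q0] := tq k; rewrite sum_ord2 => q1.
  by have := q0 ord0; have := q0 ord_max; move: q1; rewrite !mxE; lra.
have /andP[a0 a1] := q01 ord0; have /andP[b0 b1] := q01 ord_max.
split=> [|j].
  rewrite /l1_ball /= sum_abs_recr mtd_coords_max.
  under eq_bigr do rewrite mtd_coords_widen normrM (ger0_norm (lambda0 _)).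
  rewrite -mulr_sumr lambda1 mulr1.
  (* The l1 norm is [|a - b| + |a + b - 1|] with a and b the first-column entries, at most 1 on the
     unit square. *)
  by case: (ger0P (_ - _)) => ?; case: (ger0P (_ - 1)) => ?; lra.
rewrite mtd_coords_widen mulrA mulr_ge0//.
by case: ltP => ?; rewrite ?expr0 ?expr1; lra.
Qed.

Lemma cross_simplex_sub_mtd s x : (0 < l)%N -> cross_simplex s x ->
  exists q lambda, [/\ transition_matrix q, prob_simplex R l lambda &
    x = mtd_coords q lambda].
Proof.
move=> l0 [x1 x0]; pose xm := x ord0 ord_max.
pose g := \sum_(j < l) `|x ord0 (widen j)|; pose b : R := (-1) ^+ s * g.
have g0 : 0 <= g by rewrite sumr_ge0.
have xw j : x ord0 (widen j) = (-1) ^+ s * `|x ord0 (widen j)|.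
  by rewrite -[LHS](signrMK s) -(ger0_norm (x0 j)) normrM normr_sign mul1r.
have x1' : g + `|xm| <= 1 by move: x1; rewrite /l1_ball /= sum_abs_recr.
(* This is the formula of [transition_matrixE], with [xm] for the last coordinate and [b] for the
   difference of the first-column entries. *)
pose q : 'M[R]_2 :=
  \matrix_(i, j) ((1 + state_sign R j * (xm + b * state_sign R i)) / 2).
have q00 : q ord0 ord0 = (1 + (xm + b)) / 2.
  by rewrite mxE /state_sign expr0 mulr1 mul1r.
have q10 : q ord_max ord0 = (1 + (xm - b)) / 2.
  by rewrite mxE /state_sign expr0 expr1 mulrN1 mul1r.
(* If [g] is 0, the two rows of [q] agree and any distribution works; a point mass is taken, which
   exists because [l] is positive. *)
pose lambda : 'rV[R]_l := \row_j
  (if g == 0 then (j == Ordinal l0)%:R else `|x ord0 (widen j)| / g).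
exists q, lambda; split.
- move=> i; split=> [j|]; last first.
    by rewrite sum_ord2 !mxE /state_sign expr0 expr1; field.
  rewrite !mxE divr_ge0//.
  have : `|state_sign R j * (xm + b * state_sign R i)| <= 1.
    rewrite normrM norm_state_sign mul1r (le_trans (ler_normD _ _))//.
    by rewrite !normrM norm_state_sign normr_sign mul1r mulr1
      (ger0_norm g0) addrC.
  by rewrite ler_norml; lra.
- split=> [j|].
    by rewrite mxE; case: ifP => _; rewrite ?ler0n// divr_ge0.
  under eq_bigr do rewrite mxE.
  case: eqVneq => [_|g_neq0]; last by rewrite -mulr_suml divff.
  by rewrite (bigD1 (Ordinal l0))//= ?eqxx big1 ?addr0// => j /negPf ->.
- apply/rowP => j; have [->|/ord_recrP[i ->]] := eqVneq j ord_max.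
    by rewrite mtd_coords_max q00 q10 -/xm; field.
  rewrite mtd_coords_widen q00 q10 mxE.
  have -> : (1 + (xm + b)) / 2 - (1 + (xm - b)) / 2 = b by field.
  rewrite [LHS]xw /b; case: eqVneq => [g_eq0|g_neq0]; last first.
    by rewrite -mulrA; congr (_ * _); rewrite mulrC divfK.
  suff -> : `|x ord0 (widen i)| = 0 by rewrite g_eq0 !mulr0 mul0r.
  by apply: (psumr_eq0P (P := xpredT) (F := fun j => `|x ord0 (widen j)|)).
Qed.

Lemma MTD_chi_point : (0 < l)%N ->
  MTD R l 2 = (@chi_point R l @` cross_simplex false) `|`
              (@chi_point R l @` cross_simplex true).
Proof.
move=> l0; apply/seteqP; split.
  move=> _ [q [lambda [tq pl ->]]]; rewrite mtd_map_chi_point//.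
  have := cross_simplex_mtd_coords tq pl.
  by case: (_ < _) => xs; [right|left]; exists (mtd_coords q lambda).
move=> _ [] [x xs <-];
  have [q [lambda [tq pl ->]]] := cross_simplex_sub_mtd l0 xs;
  by exists q, lambda; rewrite mtd_map_chi_point.
Qed.

(** The vertices of one of the two simplices already form a basis of the linear span of the
    model. *)
Definition cross_vertex_mx : 'M[R]_(l.+2, num_words l 2) :=
  \matrix_i chi_point (cross_vertex R false i).

Lemma mulmx_cross_vertex_mx (c : 'rV[R]_l.+2) :
  c *m cross_vertex_mx =
  \sum_i c ord0 i *: chi_point (cross_vertex R false i).
Proof. by rewrite mulmx_sum_row; apply: eq_bigr => i _; rewrite rowK. Qed.

Lemma sum_mulmx_cross_vertex_mx (c : 'rV[R]_l.+2) :
  \sum_k (c *m cross_vertex_mx) ord0 k = \sum_i c ord0 i.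
Proof.
rewrite mulmx_cross_vertex_mx; under eq_bigr do rewrite summxE.
rewrite exchange_big; apply: eq_bigr => i _ /=.
under eq_bigr do rewrite mxE.
by rewrite -mulr_sumr sum_chi_point mulr1.
Qed.

Lemma row_free_cross_vertex_mx : row_free cross_vertex_mx.
Proof.
apply: inj_row_free => c cV0; apply/rowP => i; rewrite [RHS]mxE.
apply: (affinely_independent_chi_point (s := false) (c := fun i => c ord0 i)).
  rewrite -sum_mulmx_cross_vertex_mx cV0.
  by under eq_bigr do rewrite mxE; rewrite big1.
by rewrite -mulmx_cross_vertex_mx.
Qed.

Lemma chi_point_sub_cross_vertex_mx x : (chi_point x <= cross_vertex_mx)%MS.
Proof.
have [c [c1 -> _]] := cross_vertex_coords false x.
apply/submxP; exists (\row_i c i); rewrite mulmx_cross_vertex_mx.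
rewrite -chi_point_aff_comb//.
by apply: eq_bigr => i _; rewrite mxE.
Qed.

(** Every row has coordinate sum 1, so the weights producing [p] also sum to 1 and the combination
    is affine. *)
Lemma sub_cross_vertex_mx (p : 'rV[R]_(num_words l 2)) :
  (p <= cross_vertex_mx)%MS -> \sum_k p ord0 k = 1 -> exists x, p = chi_point x.
Proof.
move=> /submxP[c ->]; rewrite sum_mulmx_cross_vertex_mx => c1.
by rewrite mulmx_cross_vertex_mx chi_point_aff_comb//; eexists.
Qed.

Lemma chi_point_neq0 (x : 'rV[R]_l.+1) : chi_point x != 0.
Proof.
apply/eqP => x0; have := sum_chi_point x; rewrite x0.
by rewrite big1 => [/esym/eqP|k _]; rewrite ?oner_eq0// mxE.
Qed.

Local Notation complex_mx := (map_mx (real_complex R)).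

Lemma MTD_closureE : (0 < l)%N ->
  MTD_closure R l 2 = row_variety (complex_mx cross_vertex_mx).
Proof.
move=> l0; apply: zariski_closure_row_variety.
  move=> x [p pM xp]; apply/(row_varietyE _ xp); rewrite map_submx.
  move: pM; rewrite MTD_chi_point// => -[] [y _ <-];
    exact: chi_point_sub_cross_vertex_mx.
(* Dividing the positive integer weights by their sum [T] gives a convex combination, that is, a
   point of the model representing the same projective point. *)
move=> t; pose c i : R := (t i).+1%:R; pose T := \sum_i c i.
have T0 : 0 < T.
  by rewrite /T big_ord_recl ltr_pwDl ?ltr0n// sumr_ge0// => i _; rewrite ler0n.
pose y := \sum_i (c i / T) *: cross_vertex R false i.
have cT1 : \sum_i c i / T = 1 by rewrite -mulr_suml divff// gt_eqF.
have [x xy] : exists x : proj_space R[i] (num_words l 2),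
    homog_coords x (complex_mx (chi_point y)).
  by apply: homog_coords_exists; rewrite map_mx_eq0 chi_point_neq0.
exists x.
  exists (chi_point y) => //; rewrite MTD_chi_point//; left; exists y => //.
  rewrite -hull_cross_vertex hull_range; exists (fun i => c i / T); split=> // i.
  by rewrite divr_ge0// ?ler0n// ltW.
have -> : \row_i (t i).+1%:R = complex_mx (\row_i c i).
  by apply/rowP => i; rewrite !mxE rmorph_nat.
rewrite -map_mxM mulmx_cross_vertex_mx.
have -> : \sum_i (\row_i c i) ord0 i *: chi_point (cross_vertex R false i) =
    T *: chi_point y.
  rewrite -chi_point_aff_comb// scaler_sumr; apply: eq_bigr => i _.
  by rewrite mxE scalerA mulrC divfK// gt_eqF.
by rewrite map_mxZ; apply: homog_coordsZ => //; rewrite fmorph_eq0 gt_eqF.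
Qed.

Lemma MTD_closure_simplex : (0 < l)%N ->
  real_points (MTD_closure R l 2) `&` prob_simplex R (num_words l 2) =
  @chi_point R l @` l1_ball R l.+1.
Proof.
move=> l0; rewrite MTD_closureE//; apply/seteqP; split.
  (* A real vector in the complex span of real rows lies in their real span. *)
  move=> p [[x xV xp] pS]; move/(row_varietyE _ xp): xV; rewrite map_submx => pV.
  have [y py] := sub_cross_vertex_mx pV pS.2.
  by exists y; rewrite ?py//; apply/prob_simplex_chi_point; rewrite -py.
move=> _ [y y1 <-]; split; last exact/prob_simplex_chi_point.
have [x xy] : exists x : proj_space R[i] (num_words l 2),
    homog_coords x (complex_mx (chi_point y)).
  by apply: homog_coords_exists; rewrite map_mx_eq0 chi_point_neq0.
exists x => //; apply/(row_varietyE _ xy); rewrite map_submx.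
exact: chi_point_sub_cross_vertex_mx.
Qed.

End BinaryModel.

Unset Implicit Arguments.

Theorem theorem1 (R : realType) (l : nat) (hl : (0 < l)%N) :
  let K : set 'rV[R]_(num_words l 2) :=
    real_points (MTD_closure R l 2) `&` prob_simplex R (num_words l 2) in
  [/\ linear_subspace l.+1 (MTD_closure R l 2),
      regular_cross_polytope l.+1 K &
      exists S T : 'I_l.+2 -> 'rV[R]_(num_words l 2),
        [/\ affinely_independent S /\ (forall i, vertex K (S i)),
            affinely_independent T /\ (forall i, vertex K (T i)),
            MTD R l 2 = hull (range S) `|` hull (range T) &
            edge (hull (range S)) (hull (range S) `&` hull (range T)) /\
            edge (hull (range T)) (hull (range S) `&` hull (range T))]].
Proof.
move=> K; have KE : K = @chi_point R l @` l1_ball R l.+1.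
  exact: MTD_closure_simplex.
split.
- rewrite MTD_closureE//; eexists; last by rewrite /row_variety.
  (* Extending scalars preserves the rank, so the [l.+2] rows stay free over the complex numbers. *)
  by rewrite dim_row_vspace// /row_free mxrank_map;
    exact: row_free_cross_vertex_mx.
- exists (@chi_point R l); first exact: similarity_chi_point.
  by rewrite std_cross_polytopeE.
have vertexK s i : vertex K (chi_point (cross_vertex R s i)).
  have := face_chi_point (vertex_cross_vertex R s i).
  by rewrite KE /vertex image_set1.
have hullE s : hull (range (fun i => chi_point (cross_vertex R s i))) =
    @chi_point R l @` cross_simplex s.
  by rewrite -hull_cross_vertex -hull_chi_point.
have meetE : @chi_point R l @` cross_simplex false `&`
    @chi_point R l @` cross_simplex true =
    @chi_point R l @` @cross_diagonal R l.
  rewrite -cross_simplexI; apply/seteqP; split=> [_ [[x xs <-] [y ys]]|].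
    by move=> /chi_point_inj yx; exists x => //; split=> //; rewrite -yx.
  by move=> _ [x [x0 x1] <-]; split; exists x.
exists (fun i => chi_point (cross_vertex R false i)).
exists (fun i => chi_point (cross_vertex R true i)).
split; [| | by rewrite !hullE MTD_chi_point |].
- by split; [exact: affinely_independent_chi_point|].
- by split; [exact: affinely_independent_chi_point|].
- by rewrite !hullE meetE; split; exact: edge_chi_point.
Qed.
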